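(* Let $\{J_1,J_2,J_3\}$ be a hypercomplex structure on the $4n$-dimensional real Lie algebra $\mathfrak{g}$. If $J_\alpha$ admits a non-vanishing closed $(2n,0)$-form for some $\alpha\in\{1,2,3\}$, then $J_a$ admits a non-vanishing closed $(2n,0)$-form for any $a=(a_1,a_2,a_3)\in\mathbb{S}^2$, where $J_a:=a_1J_1+a_2J_2+a_3J_3$.
   Context: A complex structure on a real Lie algebra $\mathfrak{g}$ is a linear endomorphism $J$ with $J^2=-I$ and $[x,y]+J([Jx,y]+[x,Jy])-[Jx,Jy]=0$ for all $x,y\in\mathfrak{g}$. A hypercomplex structure on $\mathfrak{g}$ is a triple of complex structures $\{J_1,J_2,J_3\}$ on $\mathfrak{g}$ with $J_1J_2=-J_2J_1=J_3$; then each $J_a$, $a\in\mathbb{S}^2\subset\mathbb{R}^3$, is a complex structure on $\mathfrak{g}$. With respect to a complex structure $J$, a complex-valued linear form $\gamma$ on $\mathfrak{g}$ is of type $(1,0)$ if $\gamma(Jx)=i\gamma(x)$, and $(2n,0)$-forms are elements of the $2n$-th exterior power of the space of $(1,0)$-forms; closedness refers to the Chevalley–Eilenberg differential. *)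

(* Defs.v *)
From mathcomp Require Export all_boot all_order all_algebra.
From mathcomp Require Export reals complex.

Set Implicit Arguments.
Unset Strict Implicit.
Unset Printing Implicit Defensive.

Import GRing.Theory.
Local Open Scope ring_scope.
Local Open Scope complex_scope.

Record lie_bracket (R : realType) (g : vectType R) (br : g -> g -> g) : Prop :=
  LieBracket {
    lie_linearl : forall (a : R) (x y z : g),
      br (a *: x + y) z = a *: br x z + br y z;
    lie_linearr : forall (a : R) (x y z : g),
      br x (a *: y + z) = a *: br x y + br x z;
    lie_alternating : forall x : g, br x x = 0;
    lie_jacobi : forall x y z : g,
      br x (br y z) + br y (br z x) + br z (br x y) = 0
  }.

Definition complex_structure (R : realType) (g : vectType R)
    (br : g -> g -> g) (J : 'End(g)) : Prop :=
  (J \o J)%VF = - \1%VF /\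
  forall x y : g,
    br x y + J (br (J x) y + br x (J y)) - br (J x) (J y) = 0.

Definition hypercomplex_structure (R : realType) (g : vectType R)
    (br : g -> g -> g) (J1 J2 J3 : 'End(g)) : Prop :=
  [/\ complex_structure br J1,
      complex_structure br J2,
      complex_structure br J3,
      (J1 \o J2)%VF = - (J2 \o J1)%VF
    & (J1 \o J2)%VF = J3].

(* Complex-valued cochains of degree k; alternation and real multilinearity
   are not built in, they follow from membership in the exterior power
   (form_type_k0 below). *)
Definition cochain (R : realType) (g : vectType R) (k : nat) : Type :=
  ('I_k -> g) -> R[i].

(* The Chevalley-Eilenberg differential with trivial coefficients:
   (d w)(x_0, ..., x_k) = \sum_(i < j) (-1)^(i + j)
     w([x_i, x_j], x_0, ..., x_i omitted, ..., x_j omitted, ..., x_k).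
   The list of arguments has length k, so the default value of nth is never
   used. *)
Definition ce_diff (R : realType) (g : vectType R) (br : g -> g -> g)
    (k : nat) (w : cochain g k) : cochain g k.+1 :=
  fun x => \sum_(i < k.+1) \sum_(j < k.+1 | (i < j)%N)
    (-1) ^+ (i + j) *
    w (fun m : 'I_k =>
         nth 0 (br (x i) (x j) ::
                [seq x l | l <- enum 'I_k.+1 & (l != i) && (l != j)]) m).

Definition ce_closed (R : realType) (g : vectType R) (br : g -> g -> g)
    (k : nat) (w : cochain g k) : Prop :=
  forall x, ce_diff br w x = 0.

Definition real_linear_form (R : realType) (g : vectType R)
    (gamma : g -> R[i]) : Prop :=
  forall (a : R) (x y : g), gamma (a *: x + y) = a%:C * gamma x + gamma y.

Definition form_type_10 (R : realType) (g : vectType R) (J : 'End(g))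
    (gamma : g -> R[i]) : Prop :=
  real_linear_form gamma /\ forall x : g, gamma (J x) = (0 +i* 1) * gamma x.

Definition wedge (R : realType) (g : vectType R) (k : nat)
    (gamma : 'I_k -> g -> R[i]) : cochain g k :=
  fun x => \det (\matrix_(s < k, t < k) gamma s (x t)).

(* The k-th exterior power of the space of (1,0)-forms, realized as the
   complex span of the k-fold wedge products of (1,0)-forms. *)
Definition form_type_k0 (R : realType) (g : vectType R) (J : 'End(g))
    (k : nat) (w : cochain g k) : Prop :=
  exists (m : nat) (c : 'I_m -> R[i]) (gamma : 'I_m -> 'I_k -> g -> R[i]),
    (forall (r : 'I_m) (s : 'I_k), form_type_10 J (gamma r s)) /\
    (forall x, w x = \sum_(r < m) c r * wedge (gamma r) x).

(* A form on the Lie algebra corresponds to a left-invariant form on the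
   group, which vanishes nowhere as soon as it is nonzero. *)
Definition nonvanishing (R : realType) (g : vectType R) (k : nat)
    (w : cochain g k) : Prop :=
  exists x, w x <> 0.

Definition admits_closed_form (R : realType) (g : vectType R)
    (br : g -> g -> g) (J : 'End(g)) (k : nat) : Prop :=
  exists w : cochain g k,
    [/\ form_type_k0 J w, nonvanishing w & ce_closed br w].

(* Main.v *)
(* The Obata connection D of the hypercomplex structure is torsion-free and
   commutes with every J_a. For a basis gamma of the (1,0)-forms of J_a, with
   wedge product Phi, torsion-freeness gives d Phi = - theta_a /\ Phi, where
   theta_a(x) is the complex trace of D_x with respect to J_a. As J_a
   anticommutes with some complex structure commuting with D_x, the real trace
   of D_x J_a vanishes, hence theta_a(x) is half the real trace of D_x: it is
   real and does not depend on a. If Phi is closed then theta_a is a real form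
   of type (1,0), so it vanishes, and then Phi is closed for every a. *)
Require Import Defs.
From HB Require Import structures.
From mathcomp Require Import ring lra zify.

Set Implicit Arguments.
Unset Strict Implicit.
Unset Printing Implicit Defensive.

Import GRing.Theory Num.Theory passmx.
Local Open Scope ring_scope.
Local Open Scope complex_scope.

(** * Enumerations of ordinals with one or two indices omitted *)

Lemma ltn_lift n (i : 'I_n.+1) (a b : 'I_n) :
  (lift i a < lift i b)%N = (a < b)%N.
Proof. by rewrite /= /bump; case: (leqP i a) => ?; case: (leqP i b) => ?; lia. Qed.

Lemma sorted_enum_ord n : sorted (relpre val ltn) (enum 'I_n).
Proof. by rewrite -sorted_map val_enum_ord iota_ltn_sorted. Qed.

(** Both lists are strictly increasing and have the same members. *)
Lemma filter_neq_enum_ord n (i : 'I_n.+1) :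
  [seq l <- enum 'I_n.+1 | l != i] = [seq lift i l | l <- enum 'I_n].
Proof.
have ltn_tr : transitive (relpre (val : 'I_n.+1 -> nat) ltn).
  by move=> ? ? ?; apply: ltn_trans.
apply: (irr_sorted_eq ltn_tr) => [l||| l]; first exact: ltnn.
- exact: sorted_filter (sorted_enum_ord _).
- rewrite sorted_map; apply: sub_sorted (sorted_enum_ord n) => a b /=.
  by rewrite -!/(nat_of_ord (lift _ _)) ltn_lift.
rewrite mem_filter mem_enum andbT; case: (unliftP i l) => [k|] ->.
  by rewrite eq_sym neq_lift map_f ?mem_enum.
rewrite eqxx; apply/esym/mapP => -[k _ /eqP]; apply/negP; exact: neq_lift.
Qed.

(** Turns the argument list of [ce_diff], where two indices are omitted, into a composite of two
    [lift]s, the form in which minors of determinants appear. *)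
Lemma filter_neq2_enum_ord n (i : 'I_n.+2) (k : 'I_n.+1) :
  [seq l <- enum 'I_n.+2 | (l != i) && (l != lift i k)] =
  [seq lift i (lift k l) | l <- enum 'I_n].
Proof.
under eq_filter do rewrite andbC.
rewrite filter_predI filter_neq_enum_ord filter_map (map_comp (lift i) (lift k)).
rewrite -filter_neq_enum_ord; congr map; apply: eq_filter => l /=.
by rewrite (inj_eq lift_inj).
Qed.

(** * Wedge products as determinants, and their differential *)

Section Wedge.
Variables (R : realType) (g : vectType R).
Local Notation C := R[i].

Lemma eq_wedge m (gamma : 'I_m -> g -> C) x y :
  x =1 y -> wedge gamma x = wedge gamma y.
Proof. by move=> xy; congr determinant; apply/matrixP=> s t; rewrite !mxE xy. Qed.

Lemma wedge_update m (gamma : 'I_m -> g -> C) x k u :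
  wedge gamma (fun t => if t == k then u else x t) =
  \sum_s gamma s u * cofactor (\matrix_(s, t) gamma s (x t)) s k.
Proof.
rewrite /wedge (expand_det_col _ k); apply: eq_bigr => s _.
rewrite mxE eqxx; congr (_ * (_ * \det _)); apply/matrixP => a b.
by rewrite !mxE eq_sym (negPf (neq_lift _ _)).
Qed.

(** Jacobi's formula for the derivative of a determinant: by expansion along the replaced columns,
    the sum is the trace of adj(X) B X, and X adj(X) = det(X). *)
Lemma wedge_derivation m (gamma : 'I_m -> g -> C) (A : g -> g) (B : 'M[C]_m) :
    (forall s y, gamma s (A y) = \sum_t B s t * gamma t y) ->
  forall x, \sum_k wedge gamma (fun t => if t == k then A (x k) else x t) =
    \tr B * wedge gamma x.
Proof.
move=> gammaA x; set X := \matrix_(s, t) gamma s (x t).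
have -> : \tr B * wedge gamma x = \tr (\adj X *m (B *m X)).
  by rewrite mxtrace_mulC -mulmxA mul_mx_adj mul_mx_scalar mxtraceZ mulrC.
apply: eq_bigr => k _.
rewrite wedge_update mxE; apply: eq_bigr => s _; rewrite gammaA !mxE mulrC.
by congr (_ * _); apply: eq_bigr => t _; rewrite mxE.
Qed.

(** Moving [u] from slot 0 to slot [k] costs the sign (-1)^k: the expansions along these two columns
    have the same minors. *)
Lemma wedge_omit2 m (gamma : 'I_m -> g -> C) (x : 'I_m.+1 -> g) (i : 'I_m.+1) (k : 'I_m) u :
  wedge gamma (fun l => nth 0 (u :: [seq x l | l <- enum 'I_m.+1 &
                                       (l != i) && (l != lift i k)]) l) =
  (-1) ^+ k * wedge gamma (fun t => if t == k then u else x (lift i t)).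
Proof.
case: m gamma x i k => [|m] gamma x i k; first by case: k.
rewrite wedge_update mulr_sumr /wedge (expand_det_col _ ord0).
apply: eq_bigr => s _; rewrite mxE /= [RHS]mulrCA; congr (_ * _).
rewrite /cofactor addn0 exprD mulrCA !mulrA -[X in _ = X * _]mulrA -expr2 sqrr_sign mulr1.
congr (_ * \det _); apply/matrixP => a b; rewrite !mxE filter_neq2_enum_ord.
by rewrite -map_comp lift0 /= (nth_map b) ?size_enum_ord //= nth_ord_enum.
Qed.

(* Its determinant is the value at x of theta /\ gamma_0 /\ ... /\ gamma_(m-1). *)
Definition wedge1 m (gamma : 'I_m -> g -> C) (theta : g -> C)
    (x : 'I_m.+1 -> g) : 'M[C]_m.+1 :=
  \matrix_(s, t) if unlift ord0 s is Some s' then gamma s' (x t) else theta (x t).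

Lemma det_wedge1 m (gamma : 'I_m -> g -> C) (theta : g -> C) x :
  \det (wedge1 gamma theta x) =
  \sum_(i < m.+1) (-1) ^+ i * theta (x i) * wedge gamma (fun t => x (lift i t)).
Proof.
rewrite (expand_det_row _ ord0); apply: eq_bigr => i _.
rewrite mxE unlift_none mulrCA mulrA; congr (_ * \det _).
by apply/matrixP => a b; rewrite !mxE liftK.
Qed.

(** For a torsion-free D, the differential is the alternating sum of covariant derivatives.
    Splitting each bracket into its two D-terms turns the sum over i < j into a sum over all ordered
    pairs of distinct indices. *)
Lemma ce_diff_wedge (br D : g -> g -> g) m (gamma : 'I_m -> g -> C) x :
    (forall s, {morph gamma s : y z / y - z}) ->
    (forall y z, br y z = D y z - D z y) ->
  ce_diff br (wedge gamma) x =
  - \sum_(i < m.+1) (-1) ^+ i * \sum_(k < m) wedge gamma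
      (fun t => if t == k then D (x i) (x (lift i k)) else x (lift i t)).
Proof.
move=> gammaB brD.
pose W (i j : 'I_m.+1) u := wedge gamma (fun l => nth 0 (u :: [seq x l | l <- enum 'I_m.+1 & (l != i) && (l != j)]) l).
have WC i j u : W i j u = W j i u.
  apply: eq_wedge => l; congr nth; congr cons; congr map.
  by apply: eq_filter => ?; rewrite andbC.
have WB i k u v : W i (lift i k) (u - v) = W i (lift i k) u - W i (lift i k) v.
  rewrite /W !wedge_omit2 !wedge_update -mulrBr -sumrB; congr (_ * _).
  by apply: eq_bigr => s _; rewrite gammaB mulrBl.
(* The sign (-1)^(i+j), extended antisymmetrically to i > j; it absorbs the minus sign of the second
   D-term. *)
pose sg (i j : 'I_m.+1) : C := (if (i < j)%N then 1 else -1) * (-1) ^+ (i + j).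
pose T i j := sg i j * W i j (D (x i) (x j)).
have -> : ce_diff br (wedge gamma) x =
    \sum_(i < m.+1) \sum_(j < m.+1 | (i < j)%N) (T i j + T j i).
  apply: eq_bigr => i _; apply: eq_bigr => j lij.
  rewrite -/(W i j _) brD; case: (unliftP i j) lij => [k|] -> lij; last by rewrite ltnn in lij.
  rewrite WB mulrBr /T /sg lij ltnNge (ltnW lij) /= mul1r mulN1r.
  by rewrite [in X in _ = _ + X]addnC [W (lift _ _) _ _]WC mulNr.
under eq_bigr do rewrite big_split.
rewrite big_split /= [X in _ + X](exchange_big_dep xpredT) //= -big_split /=.
rewrite -sumrN; apply: eq_bigr => i _.
transitivity (\sum_(j | j != i) T i j).
  rewrite [RHS](bigID (fun j : 'I__ => (i < j)%N)) /=; congr (_ + _); apply: eq_bigl => j.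
    by rewrite -val_eqE /=; lia.
  by rewrite -val_eqE /=; lia.
have -> : \sum_(j | j != i) T i j = \sum_k T i (lift i k).
  apply: (addrI (T i i)); rewrite -(bigD1_ord i (P := xpredT)) //.
  by rewrite -(bigD1 i (P := xpredT)).
rewrite mulr_sumr -sumrN; apply: eq_bigr => k _.
rewrite /T /W wedge_omit2 mulrA -mulNr; congr (_ * _).
(* The index [lift i k] is k+1 if i <= k and k otherwise; in both cases the product of [sg] with
   (-1)^k is -(-1)^i. *)
rewrite /sg /= /bump; case: (leqP i k) => ik.
  rewrite add1n ltnS ik mul1r addnS exprS exprD -!mulrA -expr2 sqrr_sign.
  by rewrite mulr1 mulN1r.
by rewrite add0n ltnNge (ltnW ik) /= exprD -!mulrA -expr2 sqrr_sign mulr1 mulN1r.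
Qed.

End Wedge.

(** * Coordinates and traces of endomorphisms *)

Local Notation coords := (rVof (vbasis fullv)).
Local Notation lfun_mx := (mxof (vbasis fullv) (vbasis fullv)).

Section Coordinates.
Variables (R : realType) (g : vectType R).
Implicit Types f h : 'End(g).

Lemma coords_app f x : coords (f x) = coords x *m lfun_mx f.
Proof. exact: rVof_app (vbasisP _) _ _. Qed.

Lemma coords_surj (u : 'rV_(\dim {: g})) : exists x : g, coords x = u.
Proof. exists (vecof (vbasis {: g}) u); exact: vecofK (vbasisP _) _. Qed.

Lemma eq_coord (x y : g) :
  (forall k, coord (vbasis fullv) k x = coord (vbasis fullv) k y) -> x = y.
Proof.
move=> xy; apply: (can_inj (rVofK (vbasisP _))).
by apply/rowP => k; rewrite -!coord_rVof.
Qed.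

Lemma lfun_mx_comp f h : lfun_mx (f \o h)%VF = lfun_mx h *m lfun_mx f.
Proof. exact: mxof_comp (vbasisP _) _ _. Qed.

Lemma lfun_mx1 : lfun_mx (\1%VF : 'End(g)) = 1%:M.
Proof. exact: mxof1 (basis_free (vbasisP _)). Qed.

Lemma mxtrace_lfunC f h :
  \tr (lfun_mx (f \o h)%VF) = \tr (lfun_mx (h \o f)%VF).
Proof. by rewrite !lfun_mx_comp mxtrace_mulC. Qed.

End Coordinates.

(** * The Obata connection *)

Lemma lie_bracket_ad (R : realType) (g : vectType R) (br : g -> g -> g) :
  lie_bracket br -> exists ad : g -> 'End(g), forall x y, ad x y = br x y.
Proof.
case=> _ br_linear _ _.
have lin x : linear (br x) by move=> a y z; apply: br_linear.
pose adx x : {linear g -> g} :=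
  HB.pack (br x) (GRing.isLinear.Build R g g *:%R (br x) (lin x)).
by exists (fun x => linfun (adx x)) => x y; rewrite lfunE.
Qed.

Section Obata.
Variables (R : realType) (g : vectType R) (br : g -> g -> g).
Variables (J1 J2 J3 : 'End(g)).
Hypothesis br_lie : lie_bracket br.
Hypothesis J123 : hypercomplex_structure br J1 J2 J3.

Let brDl x y z : br (x + y) z = br x z + br y z.
Proof. by have := lie_linearl br_lie 1 x y z; rewrite !scale1r. Qed.
Let brDr x y z : br x (y + z) = br x y + br x z.
Proof. by have := lie_linearr br_lie 1 x y z; rewrite !scale1r. Qed.
Let br0l z : br 0 z = 0.
Proof. by have /eqP := brDl 0 0 z; rewrite addr0 eq_sym -subr_eq0 addrK => /eqP. Qed.
Let br0r z : br z 0 = 0.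
Proof. by have /eqP := brDr z 0 0; rewrite addr0 eq_sym -subr_eq0 addrK => /eqP. Qed.
Let brNl x z : br (- x) z = - br x z.
Proof. by apply/eqP; rewrite -addr_eq0 -brDl addNr br0l. Qed.
Let brNr x z : br z (- x) = - br z x.
Proof. by apply/eqP; rewrite -addr_eq0 -brDr addNr br0r. Qed.
Let brC x y : br y x = - br x y.
Proof.
apply/eqP; rewrite -addr_eq0; have := lie_alternating br_lie (x + y).
by rewrite brDl !brDr !(lie_alternating br_lie) addr0 add0r addrC => ->.
Qed.

Lemma hypercomplex_act x :
  [/\ J1 (J1 x) = - x, J2 (J2 x) = - x, J2 (J1 x) = - J1 (J2 x)
    & J3 x = J1 (J2 x)].
Proof.
case: J123 => -[/lfunP J1q _] [/lfunP J2q _] _ /lfunP J12 /lfunP J3E.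
split; last by rewrite -J3E comp_lfunE.
- by have := J1q x; rewrite !(comp_lfunE, opp_lfunE, id_lfunE).
- by have := J2q x; rewrite !(comp_lfunE, opp_lfunE, id_lfunE).
- by have := J12 x; rewrite !(comp_lfunE, opp_lfunE, id_lfunE) => ->; rewrite opprK.
Qed.

(* Obata's formula:
   2 D_x y = [x,y] + J1[J1 x,y] - J2[x,J2 y] + J3[J1 x,J2 y]. *)
Lemma obata_connection : exists D : g -> 'End(g),
  [/\ forall x y, br x y = D x y - D y x,
      forall x, (D x \o J1 = J1 \o D x)%VF
    & forall x, (D x \o J2 = J2 \o D x)%VF].
Proof.
have [ad adE] := lie_bracket_ad br_lie.
exists (fun x => 2^-1 *: (ad x + (J1 \o ad (J1 x)) - (J2 \o (ad x \o J2))
  + (J3 \o (ad (J1 x) \o J2)))%VF).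
have J11 x : J1 (J1 x) = - x by case: (hypercomplex_act x).
have J22 x : J2 (J2 x) = - x by case: (hypercomplex_act x).
have J21 x : J2 (J1 x) = - J1 (J2 x) by case: (hypercomplex_act x).
have J3E x : J3 x = J1 (J2 x) by case: (hypercomplex_act x).
have fN (f : 'End(g)) x : f (- x) = - f x by rewrite linearN.
have fD (f : 'End(g)) x y : f (x + y) = f x + f y by rewrite linearD.
have fZ (f : 'End(g)) a x : f (a *: x) = a *: f x by rewrite linearZ.
pose lfunE := (comp_lfunE, opp_lfunE, add_lfunE, scale_lfunE).
pose simpE := (J3E, J11, J22, J21, fD, fN, brNl, brNr, @opprK g).
pose cE := (linearD, linearN, linearZ, linear0).
case: J123 => -[_ N1] [_ N2] [_ N3] _ _.
split.
- move=> x y; rewrite !lfunE !adE !simpE.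
  (* Since J3 J1 = J2, integrability of J3 at (J1 x, J1 y) expresses the J3-terms by [J1 x, J1 y]
     and [J2 x, J2 y]; these cancel against what integrability of J1 and J2 at (x, y)
     contributes. *)
  move: (N1 x y) (N2 x y) (N3 (J1 x) (J1 y)).
  rewrite !simpE (brC x y) (brC x (J1 y)) (brC (J2 x) y) (brC (J2 x) (J1 y)) !simpE.
  move=> h1 h2 h3; apply: eq_coord => k.
  move/(congr1 (coord (vbasis fullv) k)): h1; move/(congr1 (coord (vbasis fullv) k)): h2.
  move/(congr1 (coord (vbasis fullv) k)): h3; rewrite !cE /=; lra.
- move=> x; apply/lfunP => y; rewrite !lfunE !adE !simpE fZ; congr (_ *: _).
  rewrite !simpE.
  (* The four terms of the formula split into two pairs; integrability of J1 settles one pair at (x,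
     y) and the other at (x, J2 y). *)
  move: (congr1 J1 (N1 x y)) (congr1 J2 (congr1 J1 (N1 x (J2 y)))).
  rewrite !(simpE, linear0) => h1 h2; apply: eq_coord => k.
  move/(congr1 (coord (vbasis fullv) k)): h1; move/(congr1 (coord (vbasis fullv) k)): h2.
  rewrite !cE /=; lra.
(* Commutation with J2 follows from the quaternion relations alone. *)
- move=> x; apply/lfunP => y; rewrite !lfunE !adE !simpE fZ; congr (_ *: _).
  rewrite !simpE; apply: eq_coord => k; rewrite !cE /=; lra.
Qed.
End Obata.

(** * Forms of type (1,0) in complex coordinates *)

Local Notation ccoords x := (map_mx (real_complex _) (coords x)).
Local Notation lfun_cmx f := (map_mx (real_complex _) (lfun_mx f)).

Lemma sqr_iC (R : realType) : 'i%C * 'i%C = -1 :> R[i].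
Proof. by rewrite -expr2 sqr_i. Qed.

Lemma scaler_half (F : numFieldType) (V : lmodType F) (u : V) :
  2^-1 *: (u + u) = u.
Proof. by rewrite -mulr2n -[u *+ 2]scaler_nat scalerA mulVf ?scale1r ?pnatr_eq0. Qed.

Section TypeForms.
Variables (R : realType) (g : vectType R).
Local Notation N := (\dim {: g}).
Local Notation C := R[i].
Implicit Types (f h J : 'End(g)).

Lemma ccoords_app f (x : g) : ccoords (f x) = ccoords x *m lfun_cmx f.
Proof. by rewrite coords_app map_mxM. Qed.

Lemma ccoords_surj k : exists x : g, ccoords x = delta_mx 0 k.
Proof. by have [x xk] := coords_surj (delta_mx 0 k); exists x; rewrite xk map_delta_mx. Qed.

Lemma eq_ccoords_mul p (A B : 'M[C]_(N, p)) :
  (forall x : g, ccoords x *m A = ccoords x *m B) -> A = B.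
Proof.
by move=> AB; apply/row_matrixP => k; have [x xk] := ccoords_surj k; rewrite !rowE -xk.
Qed.

Lemma real_linear_formP (gamma : g -> C) : real_linear_form gamma ->
  exists c : 'cV_N, forall x, gamma x = (ccoords x *m c) 0 0.
Proof.
move=> gammaP.
have gamma0 : gamma 0 = 0.
  have /eqP := gammaP 1 0 0.
  by rewrite scaler0 addr0 mul1r eq_sym -subr_eq0 addrK => /eqP.
exists (\col_k gamma (vbasis fullv)`_k) => x; rewrite mxE.
rewrite [in LHS](coord_basis (vbasisP fullv) (memvf x)).
under [RHS]eq_bigr do rewrite !mxE.
apply: (big_rec2 (fun u v => gamma u = v)) => // k v u _ <-.
by rewrite gammaP.
Qed.

(** The columns of [G] are the coefficient vectors of m complex-valued forms. Composing a form with
    J multiplies its column on the left by the matrix of J, so (1,0)-forms correspond to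
    i-eigenvectors. *)
Definition col_form m (G : 'M[C]_(N, m)) (s : 'I_m) (x : g) : C :=
  (ccoords x *m G) 0 s.

Lemma col_form_linear m (G : 'M[C]_(N, m)) s : real_linear_form (col_form G s).
Proof.
move=> a x y; rewrite /col_form linearP /= map_mxD map_mxZ mulmxDl -scalemxAl.
by rewrite !mxE.
Qed.

Lemma col_form_app m (G : 'M[C]_(N, m)) (A : 'End(g)) (B : 'M_m) s x :
  lfun_cmx A *m G = G *m B ->
  col_form G s (A x) = \sum_t B t s * col_form G t x.
Proof.
move=> AG; rewrite /col_form ccoords_app -mulmxA AG mulmxA mxE.
by apply: eq_bigr => t _; rewrite mulrC.
Qed.

Lemma col_form_type10 J m (G : 'M[C]_(N, m)) s :
  lfun_cmx J *m G = 'i%C *: G -> form_type_10 J (col_form G s).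
Proof.
move=> JG; split; first exact: col_form_linear.
by move=> x; rewrite /col_form ccoords_app -mulmxA JG -scalemxAr mxE.
Qed.

(** [G] has rank m, hence an invertible m by m minor; the basis vectors that index its rows serve as
    arguments. *)
Lemma wedge_col_form_neq0 m (G : 'M[C]_(N, m)) (L : 'M_(m, N)) :
  L *m G = 1%:M -> exists x, wedge (col_form G) x <> 0.
Proof.
move=> LG; have Gfull : row_full G by apply/row_fullP; exists L.
have [x xE] := fin_all_exists (fun t => ccoords_surj (fullrankfun Gfull t)).
exists x; rewrite /wedge.
have -> : \matrix_(s, t) col_form G s (x t) = (rowsub (fullrankfun Gfull) G)^T.
  by apply/matrixP => s t; rewrite mxE /col_form xE -rowE !mxE.
rewrite det_tr; apply/eqP; rewrite -unitfE -unitmxE; exact: fullrowsub_unit.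
Qed.

(* G * L is the rank factorization of the projector onto the i-eigenspace. *)
Lemma type10_basis J m :
    (J \o J)%VF = - \1%VF -> N = (2 * m)%N ->
  exists (G : 'M[C]_(N, m)) (L : 'M[C]_(m, N)),
    [/\ L *m G = 1%:M, lfun_cmx J *m G = 'i%C *: G
      & G *m L = 2^-1 *: (1%:M - 'i%C *: lfun_cmx J)].
Proof.
move=> JJ dimg; set A := lfun_cmx J; set p := _ *: (1%:M - _).
have AA : A *m A = - 1%:M.
  by rewrite -map_mxM -lfun_mx_comp JJ linearN /= lfun_mx1 map_mxN map_mx1.
have Ap : A *m p = 'i%C *: p.
  rewrite -scalemxAr scalerA mulrC -scalerA; congr (_ *: _).
  rewrite mulmxBr mulmx1 -scalemxAr AA scalerBr scalerA sqr_iC scaleN1r opprK.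
  by rewrite scalerN opprK addrC.
have pp : p *m p = p.
  rewrite {1}/p -scalemxAl mulmxBl mul1mx -scalemxAl Ap scalerA sqr_iC.
  by rewrite scaleN1r opprK scaler_half.
(* Conjugation exchanges the projectors onto the two eigenspaces, since the matrix of J is real.
   Their ranks are therefore equal, and they add up to 2m. *)
have q_conj : map_mx (@conjc R) p = 1%:M - p.
  have conjA : map_mx (@conjc R) A = A.
    by rewrite -map_mx_comp; apply: eq_map_mx => a; apply: conjc_real.
  apply/eqP; rewrite eq_sym subr_eq /p map_mxZ fmorphV rmorph_nat map_mxB map_mx1.
  have -> : map_mx (@conjc R) ('i%C *: A) = - ('i%C *: A).
    rewrite map_mxZ conjA -scaleNr; congr (_ *: _).
    by apply/eqP; rewrite eq_complex /= oppr0 !eqxx.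
  by rewrite -scalerDr opprK addrACA subrr addr0 scaler_half.
have rank_p : \rank p = m.
  have : (\rank p + \rank (1%:M - p)%R = 2 * m)%N.
    apply/eqP; rewrite eqn_leq -dimg mulmx0_rank_max ?mulmxBr ?mulmx1 ?pp ?subrr //=.
    have : (\rank (p + (1%:M - p))%R <= \rank p + \rank (1%:M - p)%R)%N.
      exact: mxrank_add.
    by rewrite addrCA subrr addr0 mxrank1.
  by rewrite -q_conj mxrank_map; lia.
rewrite -rank_p; exists (col_base p), (row_base p).
move: (mulmx_base p) (col_base_full p) (row_base_free p).
move: (col_base p) (row_base p) => G L pE /row_full_inj G_inj /row_free_inj L_inj.
split => //; last by apply: L_inj; rewrite -scalemxAl -mulmxA pE.
(* As p is idempotent, G L G L = G L; cancel G on the left and L on the right. *)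
by apply: G_inj; apply: L_inj; rewrite mulmx1 mulmxA pE -mulmxA pE.
Qed.

(** The projector G L fixes every i-eigenvector c, so c = G (L c) and the entries of L c are the
    coefficients. *)
Lemma type10_factor J m (G : 'M[C]_(N, m)) (L : 'M[C]_(m, N)) gamma :
    G *m L = 2^-1 *: (1%:M - 'i%C *: lfun_cmx J) ->
    form_type_10 J gamma ->
  exists b : 'I_m -> C, forall x, gamma x = \sum_t b t * col_form G t x.
Proof.
move=> GL [/real_linear_formP[c gammaE] gammaJ].
have Jc : lfun_cmx J *m c = 'i%C *: c.
  apply: eq_ccoords_mul => x; rewrite mulmxA -ccoords_app -scalemxAr.
  by apply/matrixP => a b; rewrite !ord1 -gammaE gammaJ mxE gammaE.
exists (fun t => (L *m c) t 0) => x.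
have -> : gamma x = (ccoords x *m G *m (L *m c)) 0 0.
  rewrite -mulmxA (mulmxA G) GL -scalemxAl mulmxBl mul1mx -scalemxAl Jc.
  by rewrite scalerA sqr_iC scaleN1r opprK scaler_half.
by rewrite mxE; apply: eq_bigr => t _; rewrite mulrC.
Qed.

(** The (1,0)-forms are spanned by the m columns of [G], so their m-th exterior power is at most a
    line: a change of forms by a matrix b multiplies the wedge by det b. *)
Lemma type_top_wedge J m (G : 'M[C]_(N, m)) (L : 'M[C]_(m, N)) w :
    G *m L = 2^-1 *: (1%:M - 'i%C *: lfun_cmx J) ->
    form_type_k0 J w ->
  exists c, forall x, w x = c * wedge (col_form G) x.
Proof.
move=> GL [p [c [gamma [gamma10 wE]]]].
have gammaE r : exists b : 'M[C]_m, forall s x,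
    gamma r s x = \sum_t b s t * col_form G t x.
  have [b bE] := fin_all_exists (fun s => type10_factor GL (gamma10 r s)).
  exists (\matrix_(s, t) b s t) => s x; rewrite bE.
  by apply: eq_bigr => t _; rewrite mxE.
have [b bE] := fin_all_exists gammaE.
exists (\sum_r c r * \det (b r)) => x; rewrite wE mulr_suml.
apply: eq_bigr => r _; rewrite -mulrA -det_mulmx; congr (_ * \det _).
by apply/matrixP => s t; rewrite !mxE bE; apply: eq_bigr => u _; rewrite mxE.
Qed.

(** When f commutes with J, the left side is the complex trace of f with respect to J. By cyclicity
    it is the trace of f times the projector, that is (tr f - i tr(f J)) / 2. *)
Lemma mxtrace_type10 J m (G : 'M[C]_(N, m)) (L : 'M[C]_(m, N)) f :
    G *m L = 2^-1 *: (1%:M - 'i%C *: lfun_cmx J) ->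
    \tr (lfun_mx (f \o J)%VF) = 0 ->
  \tr (L *m (lfun_cmx f *m G)) = (\tr (lfun_mx f) / 2)%:C.
Proof.
move=> GL trfJ; rewrite mxtrace_mulC -mulmxA GL -scalemxAr mulmxBr mulmx1.
rewrite -scalemxAr -map_mxM -lfun_mx_comp linearZ /= linearB linearZ /=.
rewrite !trace_map_mx mxtrace_lfunC trfJ rmorph0 mulr0 subr0.
by rewrite rmorphM fmorphV rmorph_nat mulrC.
Qed.

End TypeForms.

(** * Closed forms and the trace of the connection *)

Lemma det_wedge1_type10 (R : realType) (g : vectType R) (J : 'End(g)) m
    (gamma : 'I_m -> g -> R[i]) (theta : g -> R[i]) :
    (forall s, form_type_10 J (gamma s)) -> nonvanishing (wedge gamma) ->
    (forall x, \det (wedge1 gamma theta x) = 0) ->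
  forall v, theta (J v) = 'i%C * theta v.
(* Expanding along the column of v writes theta as a combination of the gamma_s. *)
Proof.
move=> gammaJ [y /eqP Phi_neq0] det0 v.
pose x u (t : 'I_m.+1) := if unlift ord0 t is Some t' then y t' else u.
have xE u : x u ord0 = u by rewrite /x unlift_none.
(* Cofactors along column 0 ignore the argument placed there, so these coefficients, computed at
   [v], serve every [u], in particular [J v]. *)
pose c s := cofactor (wedge1 gamma theta (x v)) (lift ord0 s) ord0.
have detE u : theta u * wedge gamma y + \sum_s gamma s u * c s = 0.
  rewrite -[RHS](det0 (x u)) (expand_det_col _ ord0) big_ord_recl.
  congr (_ + _); last apply: eq_bigr => s _.
    rewrite mxE unlift_none xE /cofactor addn0 expr0 mul1r.
    by congr (_ * \det _); apply/matrixP => a b; rewrite !mxE liftK /x liftK.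
  rewrite mxE liftK xE /c /cofactor; congr (_ * (_ * \det _)).
  by apply/matrixP => a b; rewrite !mxE /x !liftK.
have sumJ : \sum_s gamma s (J v) * c s = 'i%C * \sum_s gamma s v * c s.
  by rewrite mulr_sumr; apply: eq_bigr => s _; rewrite (gammaJ s).2 mulrA.
apply: (mulIf Phi_neq0); apply/eqP; rewrite -mulrA -subr_eq0 -mulrN.
by rewrite (addr0_eq (detE v)) -sumJ detE.
Qed.

(** Comparison of imaginary parts; it makes a real form of type (1,0) vanish. *)
Lemma eq_realM_i (R : realType) (a b : R) : a%:C = 'i%C * b%:C -> b = 0.
Proof.
by case=> _; rewrite mul0r mul1r add0r.
Qed.

Section Parallel.
Variables (R : realType) (g : vectType R) (br : g -> g -> g).
Variables (m : nat) (J : 'End(g)) (D : g -> 'End(g)).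
Hypothesis dimg : \dim {: g} = (2 * m)%N.
Hypothesis JJ : (J \o J)%VF = - \1%VF.
Hypothesis torsion_free : forall x y, br x y = D x y - D y x.
Hypothesis DJ : forall x, (D x \o J = J \o D x)%VF.
Hypothesis trDJ : forall x, \tr (lfun_mx (D x \o J)%VF) = 0.

Lemma ce_diff_type10 (G : 'M[R[i]]_(\dim {: g}, m)) (L : 'M[R[i]]_(m, \dim {: g})) x :
    lfun_cmx J *m G = 'i%C *: G ->
    G *m L = 2^-1 *: (1%:M - 'i%C *: lfun_cmx J) ->
  ce_diff br (wedge (col_form G)) x =
  - \det (wedge1 (col_form G) (fun v => (\tr (lfun_mx (D v)) / 2)%:C) x).
Proof.
move=> JG GL; rewrite (ce_diff_wedge (D := fun y z => D y z)) //; last first.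
  move=> s y z; have lin := col_form_linear G s.
  by rewrite addrC -scaleN1r lin rmorphN1 mulN1r addrC.
congr (- _); rewrite det_wedge1; apply: eq_bigr => i _; rewrite -mulrA.
congr (_ * _); rewrite -(mxtrace_type10 GL) // -mxtrace_tr.
set B := (L *m _)^T.
(* D commutes with J, hence with the projector G L, which fixes G. The span of the columns of [G] is
   thus stable under D. *)
have AG : lfun_cmx (D (x i)) *m G = G *m (L *m (lfun_cmx (D (x i)) *m G)).
  rewrite mulmxA GL -scalemxAl mulmxBl mul1mx -scalemxAl mulmxA -map_mxM.
  rewrite -lfun_mx_comp DJ lfun_mx_comp map_mxM -mulmxA JG -scalemxAr scalerA.
  by rewrite sqr_iC scaleN1r opprK scaler_half.
apply: wedge_derivation => s y; rewrite (col_form_app _ _ AG).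
by apply: eq_bigr => t _; rewrite [B _ _]mxE.
Qed.

(** The right side does not mention J, which allows passing from one complex structure to another
    with the same parallel connection D. *)
Lemma admits_closed_formP :
  admits_closed_form br J m <-> forall x, \tr (lfun_mx (D x)) = 0.
Proof.
have [G [L [LG JG GL]]] := type10_basis JJ dimg.
have gammaJ s := col_form_type10 s JG.
split=> [[w [w_type [y wy] w_closed]] v | trD].
  have [c wE] := type_top_wedge GL w_type.
  have c_neq0 : c != 0 by apply: contra_notN wy => /eqP c0; rewrite wE c0 mul0r.
  have Phi_y : wedge (col_form G) y <> 0.
    by move=> Phi0; apply: wy; rewrite wE Phi0 mulr0.
  (* The form w is c times the wedge of the basis with c nonzero, so closedness of w passes to that
     wedge. *)
  have det0 x : \det (wedge1 (col_form G) (fun v => (\tr (lfun_mx (D v)) / 2)%:C) x) = 0.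
    apply: (mulfI c_neq0); apply: oppr_inj.
    rewrite mulr0 oppr0 -mulrN -(ce_diff_type10 _ JG GL) -[RHS](w_closed x).
    rewrite /ce_diff mulr_sumr; apply: eq_bigr => a _.
    rewrite mulr_sumr; apply: eq_bigr => b _.
    by rewrite wE mulrCA.
  have := det_wedge1_type10 gammaJ (ex_intro _ y Phi_y) det0 v.
  by move/eq_realM_i/eqP; rewrite mulf_eq0 invr_eq0 pnatr_eq0 orbF => /eqP.
exists (wedge (col_form G)); split.
- exists 1%N, (fun=> 1), (fun=> col_form G); split => [_ s|x]; first exact: gammaJ.
  by rewrite big_ord1 mul1r.
- exact: wedge_col_form_neq0 LG.
move=> x; rewrite (ce_diff_type10 _ JG GL) det_wedge1 big1 ?oppr0 // => i _.
by rewrite trD mul0r rmorph0 mulr0 mul0r.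
Qed.

End Parallel.

(** * Vanishing of the traces, and the conclusion *)

(** Conjugation by K fixes A and negates J, so A J is similar to -A J and its trace is its own
    opposite. *)
Lemma mxtrace_anticommute (R : realType) (g : vectType R) (A J K : 'End(g)) :
    (forall x, K (K x) = - x) -> (forall x, K (J x) = - J (K x)) ->
    (forall x, A (K x) = K (A x)) ->
  \tr (lfun_mx (A \o J)%VF) = 0.
Proof.
move=> KK KJ AK; set T := \tr _.
have AJ : (A \o J = - ((A \o J \o K) \o K))%VF.
  by apply/lfunP => x; rewrite !(comp_lfunE, opp_lfunE) KK !linearN opprK.
have KAJK : (K \o (A \o J \o K) = A \o J)%VF.
  by apply/lfunP => x; rewrite !comp_lfunE -AK KJ KK !linearN opprK.
have TN : T = - T by rewrite {1}/T AJ !linearN /= mxtrace_lfunC KAJK.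
by apply/eqP; rewrite -[_ == _](mulrn_eq0 _ 2) mulr2n {1}TN addNr.
Qed.

Theorem theorem6p1 (R : realType) (n : nat) (g : vectType R)
    (br : g -> g -> g) (J1 J2 J3 : 'End(g)) :
  \dim {: g} = (4 * n)%N ->
  lie_bracket br ->
  hypercomplex_structure br J1 J2 J3 ->
  [\/ admits_closed_form br J1 (2 * n),
      admits_closed_form br J2 (2 * n)
    | admits_closed_form br J3 (2 * n)] ->
  forall a1 a2 a3 : R,
    a1 ^+ 2 + a2 ^+ 2 + a3 ^+ 2 = 1 ->
    admits_closed_form br (a1 *: J1 + a2 *: J2 + a3 *: J3) (2 * n).
Proof.
move=> dimg br_lie J123 J_form.
have [D [torsion_free DJ1 DJ2]] := obata_connection br_lie J123.
have J11 x : J1 (J1 x) = - x by case: (hypercomplex_act J123 x).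
have J22 x : J2 (J2 x) = - x by case: (hypercomplex_act J123 x).
have J21 x : J2 (J1 x) = - J1 (J2 x) by case: (hypercomplex_act J123 x).
have J3E x : J3 x = J1 (J2 x) by case: (hypercomplex_act J123 x).
have DJ1x x y : D x (J1 y) = J1 (D x y) by rewrite -!comp_lfunE DJ1.
have DJ2x x y : D x (J2 y) = J2 (D x y) by rewrite -!comp_lfunE DJ2.
have dimg2 : \dim {: g} = (2 * (2 * n))%N by rewrite dimg mulnA.
(* J2 plays the role of K for J1, and J1 does so for J2 and J3; the trace for a general J_a then
   vanishes by linearity. *)
have trDJ1 x : \tr (lfun_mx (D x \o J1)%VF) = 0.
  by apply: (mxtrace_anticommute J22).
have J12 x : J1 (J2 x) = - J2 (J1 x) by rewrite J21 opprK.
have trDJ2 x : \tr (lfun_mx (D x \o J2)%VF) = 0.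
  by apply: (mxtrace_anticommute J11).
have trDJ3 x : \tr (lfun_mx (D x \o J3)%VF) = 0.
  by apply: (mxtrace_anticommute J11) => // y; rewrite !J3E J21 linearN opprK.
have formP a1 a2 a3 : a1 ^+ 2 + a2 ^+ 2 + a3 ^+ 2 = 1 ->
    admits_closed_form br (a1 *: J1 + a2 *: J2 + a3 *: J3) (2 * n) <->
    forall x, \tr (lfun_mx (D x)) = 0.
  move=> a_unit; apply: admits_closed_formP => // [|x|x].
  (* The square of J_a is -(a1^2 + a2^2 + a3^2), the mixed terms cancelling; the coefficient 1 of x
     is rewritten as this sum of squares. *)
  - apply/lfunP => x; rewrite !(comp_lfunE, add_lfunE, scale_lfunE, opp_lfunE).
    rewrite id_lfunE -[in RHS](scale1r x) -a_unit !J3E.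
    have fN (f : 'End(g)) u : f (- u) = - f u by rewrite linearN.
    have fD (f : 'End(g)) u v : f (u + v) = f u + f v by rewrite linearD.
    have fZ (f : 'End(g)) a u : f (a *: u) = a *: f u by rewrite linearZ.
    rewrite !(fD, fZ, J11, J22, J21, fN).
    apply: eq_coord => k; rewrite !(linearD, linearN, linearZ) /=.
    ring.
  - apply/lfunP => y; rewrite !(comp_lfunE, add_lfunE, scale_lfunE).
    by rewrite !linearD !linearZ /= !J3E !DJ1x DJ2x.
  rewrite !comp_lfunDr -!comp_lfunZr !linearD !linearZ /=.
  by rewrite trDJ1 trDJ2 trDJ3 !mulr0 !addr0.
move=> a1 a2 a3 /formP ->.
(* Each given J_alpha is J_a for a standard basis vector a, so the same criterion yields the trace
   condition. *)
case: J_form => [J1_form|J2_form|J3_form].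
- by apply/(formP 1 0 0); rewrite ?scale1r ?scale0r ?addr0 // expr1n expr0n /= !addr0.
- by apply/(formP 0 1 0); rewrite ?scale1r ?scale0r ?addr0 ?add0r // expr1n expr0n /= addr0 add0r.
- by apply/(formP 0 0 1); rewrite ?scale1r ?scale0r ?addr0 ?add0r // expr1n expr0n /= !add0r.
Qed.
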